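(* Let $F$ be a field of characteristic $0$, let $R\in F[X]$ be a polynomial of degree $d\ge0$, let $q\in F[X]$ be a polynomial of degree $l\ge1$ without constant term, and let $G=R(x\partial_x)\partial_x$ be acting on $F[x]$. For $n=0,1,2,\dots$ put $$P_n^q(x)=e^{q(G)}x^n=\sum_{j\ge0}\frac{q(G)^jx^n}{j!}.$$ Then: (i) The polynomials $P_n^q$ are eigenfunctions of the differential operator $L=q'(G)G+x\partial_x$. (ii) They satisfy a recurrence relation of the form $$xP_n^q(x)=P_{n+1}^q(x)+\sum_{j=0}^{ld+l-1}\gamma_j(n)P_{n-j}^q(x)$$ with constants $\gamma_j(n)\in F$ independent of $x$. (iii) The operator $G$ is a lowering operator, $GP_n^q(x)=nR(n-1)P_{n-1}^q(x)$, and the operator $M=\sigma_q(x)$ is a raising operator, $MP_n^q(x)=P_{n+1}^q(x)$. (iv) The Rodrigues-like formula $P_n^q(x)=M^n1$ holds.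
   Context: $\partial_x$ is differentiation on $F[x]$ and $x$ also denotes the operator of multiplication by $x$. The operator $q(G)$ lowers degree, so the series defining $P_n^q$ is finite. $\mathrm{ad}_{B}(A)=BA-AB$ and $\sigma_q(A)=e^{\mathrm{ad}_{q(G)}}(A)=\sum_{j\ge0}\mathrm{ad}_{q(G)}^j(A)/j!$ for $A$ in the algebra generated by $x$, $x\partial_x$, $G$ (on which $\mathrm{ad}_{q(G)}$ is locally nilpotent, so the sum is finite). $q'$ is the derivative of $q$. Convention: $P_k^q=0$ for $k<0$. *)

(* Defs.v *)
From mathcomp Require Import all_boot all_order all_algebra.
From mathcomp Require Import boolp classical_sets functions cardinality fsbigop.

Set Implicit Arguments.
Unset Strict Implicit.
Unset Printing Implicit Defensive.

Import GRing.Theory.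

Local Open Scope ring_scope.

(* Operators are plain functions on F[x], added and scaled pointwise, composed
   with \o. *)
Notation operator F := ({poly F} -> {poly F}).

(* The operator p(A), with A ^ i the i-fold composition. *)
Definition op_poly (F : fieldType) (p : {poly F}) (A : operator F) :
    operator F :=
  fun f => \sum_(i < size p) p`_i *: iter i A f.

Definition mulX (F : fieldType) : operator F := fun f => 'X * f.

Definition ddx (F : fieldType) : operator F := fun f => f^`().

Definition xddx (F : fieldType) : operator F := @mulX F \o @ddx F.

Definition opG (F : fieldType) (R : {poly F}) : operator F :=
  op_poly R (@xddx F) \o @ddx F.

Definition ad (F : fieldType) (B A : operator F) : operator F :=
  (B \o A) - (A \o B).

(* e^T v, for T nilpotent at v; the sum over all of nat is a sum over the
   support of its summand, and takes the junk value 0 only if that support is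
   infinite. It is used with V := {poly F} and with V := operator F. *)
Definition expv (F : fieldType) (V : lmodType F) (T : V -> V) (v : V) : V :=
  \sum_(j \in [set: nat]) (j`!%:R^-1 : F) *: iter j T v.

(* P_k^q for an integer index, so that P_k^q = 0 for k < 0. *)
Definition Pq (F : fieldType) (R q : {poly F}) (k : int) : {poly F} :=
  match k with
  | Posz n => expv (op_poly q (opG R)) 'X^n
  | Negz _ => 0
  end.

Definition sigma (F : fieldType) (R q : {poly F}) (A : operator F) :
    operator F :=
  expv (ad (op_poly q (opG R))) A.

Definition opL (F : fieldType) (R q : {poly F}) : operator F :=
  (op_poly q^`() (opG R) \o opG R) + @xddx F.

Definition opM (F : fieldType) (R q : {poly F}) : operator F :=
  sigma R q (@mulX F).

Definition eigenfunction (F : fieldType) (A : operator F) (f : {poly F}) :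
    Prop :=
  f != 0 /\ exists lam : F, A f = lam *: f.

(* Main.v *)
(* Write Q = q(G), H = x d/dx and E = e^Q. The binomial expansions of Q^k A and
   of A Q^k in terms of the ad_Q^j A give E A = sigma_q(A) E and
   A E = E (sum_j (-1)^j ad_Q^j(A) / j!) whenever ad_Q is nilpotent at A.
   - A = H: ad_Q(H) = q'(G) G commutes with Q, so L E = E H, which is (i).
   - A = x: the operators sum_a G^a p_a(H) are stable under ad_Q, which raises
     the range of a by l and, as [p(H), G^i] = G^i (p(H - i) - p(H)), lowers the
     degrees of the p_a. Since [Q, x] has a < l and degrees at most d, the
     operator ad_Q^(j+1)(x) has a < l + jl and degrees at most d - j; hence
     ad_Q^(d+2)(x) = 0. This gives the raising operator, and expands
     x P_n = E (e^(-ad_Q)(x) x^n) with a < ld + l, where E G^a x^n is a multiple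
     of P_(n-a). *)
Require Import Defs.
From mathcomp Require Import all_boot all_order all_algebra.
From HB Require Import structures.
From mathcomp Require Import boolp functions fsbigop.
From mathcomp Require Import ring.

Set Implicit Arguments.
Unset Strict Implicit.
Unset Printing Implicit Defensive.

Import GRing.Theory.

Local Open Scope ring_scope.

(** * Iterates of a linear map *)

Section IteratedLinear.
Variables (K : pzRingType) (V : lmodType K) (A : {linear V -> V}).

Lemma iter_is_linear n : linear (iter n A).
Proof.
by move=> a u v; elim: n => //= n ->; rewrite linearP.
Qed.

HB.instance Definition _ n :=
  GRing.isLinear.Build K V V *:%R (iter n A) (iter_is_linear n).

Lemma iter_eq0_leq m n v : iter m A v = 0 -> (m <= n)%N -> iter n A v = 0.
Proof. by move=> Av0 /subnK <-; rewrite iterD Av0 linear0. Qed.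

End IteratedLinear.

(** * Linearity of the operators on [{poly F}] and of [ad] *)

Section LinearOperators.
Variable F : fieldType.

Lemma op_poly_is_linear (p : {poly F}) (A : {linear {poly F} -> {poly F}}) :
  linear (op_poly p A).
Proof.
move=> a u v; rewrite /op_poly scaler_sumr -big_split /=.
by apply: eq_bigr => i _; rewrite linearP scalerDr !scalerA mulrC.
Qed.

HB.instance Definition _ p (A : {linear {poly F} -> {poly F}}) :=
  GRing.isLinear.Build F {poly F} {poly F} *:%R (op_poly p A)
    (@op_poly_is_linear p A).

Lemma mulX_is_linear : linear (@mulX F).
Proof. by move=> a u v; rewrite /mulX mulrDr scalerAr. Qed.

HB.instance Definition _ :=
  GRing.isLinear.Build F {poly F} {poly F} *:%R (@mulX F) mulX_is_linear.

Lemma ddx_is_linear : linear (@ddx F).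
Proof. by move=> a u v; rewrite /ddx linearP. Qed.

HB.instance Definition _ :=
  GRing.isLinear.Build F {poly F} {poly F} *:%R (@ddx F) ddx_is_linear.

HB.instance Definition _ := GRing.Linear.copy (@xddx F) (@mulX F \o @ddx F).

HB.instance Definition _ (R : {poly F}) :=
  GRing.Linear.copy (opG R) (op_poly R (@xddx F) \o @ddx F).

Lemma comm_op_poly (p : {poly F}) (A B : {linear {poly F} -> {poly F}}) :
  (forall f, A (B f) = B (A f)) ->
  forall f, op_poly p A (B f) = B (op_poly p A f).
Proof.
move=> AB f; rewrite linear_sum; apply: eq_bigr => i _; rewrite linearZ /=.
by congr (_ *: _); elim: (i : nat) => //= n ->.
Qed.

Lemma ad_is_linear (B : {linear {poly F} -> {poly F}}) : linear (ad B).
Proof.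
move=> a X Y; apply/funext => f.
rewrite -[RHS]/(a *: (B (X f) - X (B f)) + (B (Y f) - Y (B f))).
rewrite -[LHS]/(B (a *: X f + Y f) - (a *: X (B f) + Y (B f))).
by rewrite linearP scalerBr opprD addrACA.
Qed.

HB.instance Definition _ (B : {linear {poly F} -> {poly F}}) :=
  GRing.isLinear.Build F _ _ *:%R (ad B) (@ad_is_linear B).

(** Named so that its linearity in the polynomial can be registered, apart from the linearity of
    [iter j (ad B)] in the operator. *)
Definition iter_ad (B A : operator F) j : operator F := iter j (ad B) A.

Lemma iter_adS (B A : operator F) j f :
  iter_ad B A j.+1 f = B (iter_ad B A j f) - iter_ad B A j (B f).
Proof. by []. Qed.

Lemma iter_ad_is_linear (B A : {linear {poly F} -> {poly F}}) j :
  linear (iter_ad B A j).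
Proof.
elim: j => [|j IH] a u v; first exact: linearP.
by rewrite !iter_adS linearP !IH linearP scalerBr opprD addrACA.
Qed.

HB.instance Definition _ (B A : {linear {poly F} -> {poly F}}) j :=
  GRing.isLinear.Build F {poly F} {poly F} *:%R (iter_ad B A j)
    (@iter_ad_is_linear B A j).

End LinearOperators.

(** * The exponential series of a nilpotent map as a finite sum *)

Section FiniteExponential.
Variables (F : fieldType) (V : lmodType F) (T : {linear V -> V}).

Lemma expvE m v : iter m T v = 0 ->
  expv T v = \sum_(j < m) (j`!%:R^-1 : F) *: iter j T v.
Proof.
move=> Tm0; rewrite /expv (@fsbigE _ _ _ _ _ (index_iota 0 m)) ?iota_uniq //.
  rewrite big_mkord; apply: eq_big => // i; exact/asboolP.
move=> i _; rewrite mem_index_iota /= -leqNgt => le_m_i.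
by rewrite (iter_eq0_leq Tm0) // scaler0.
Qed.

End FiniteExponential.

(** * Binomial convolution and the Cauchy product of exponential series *)

Section Convolution.
Variables (F : fieldType) (V : lmodType F).
Implicit Type w : nat -> nat -> V.

Definition bin_conv w k := \sum_(j < k.+1) w j (k - j)%N *+ 'C(k, j).

(** Pascal's rule, in the form in which it drives the Leibniz expansions of [Q^k A] and [A Q^k]. *)
Lemma bin_convS w k : bin_conv w k.+1 =
  bin_conv (fun j => w j.+1) k + bin_conv (fun j i => w j i.+1) k.
Proof.
rewrite /bin_conv big_ord_recl bin0.
under eq_bigr => j _ do rewrite lift0 subSS binS mulrnDr.
rewrite big_split /= addrA addrC; congr (_ + _).
(* The top term carries the binomial ['C(k, k.+1)], which is 0. *)
rewrite big_ord_recr /= bin_small // mulr0n addr0.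
rewrite [RHS]big_ord_recl !bin0 !subn0; congr (_ + _).
by apply: eq_bigr => j _; rewrite lift0 subnSK.
Qed.

Hypothesis charF0 : [pchar F] =i pred0.

Lemma fact_neq0 n : (n`!%:R : F) != 0.
Proof. by rewrite ((pcharf0P F).1 charF0) -lt0n fact_gt0. Qed.

Lemma bin_div_fact k j : (j <= k)%N ->
  (k`!%:R^-1 : F) *+ 'C(k, j) = j`!%:R^-1 * (k - j)`!%:R^-1.
Proof.
move=> le_jk; apply: (mulfI (fact_neq0 k)); rewrite mulrnAr.
rewrite mulfV ?fact_neq0 // -(bin_fact le_jk) !natrM -invfM mulfK //.
by rewrite mulf_neq0 ?fact_neq0.
Qed.

Lemma sum_triangle w N :
  \sum_(k < N) \sum_(j < k.+1) w j (k - j)%N =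
  \sum_(j < N) \sum_(i < N - j) w j i.
Proof.
elim: N => [|N IH]; first by rewrite !big_ord0.
rewrite big_ord_recr /= IH [RHS]big_ord_recr /= subSnn big_ord1.
rewrite [X in _ + X]big_ord_recr /= subnn addrA; congr (_ + _).
rewrite -big_split; apply: eq_bigr => j _ /=.
by rewrite subSn 1?ltnW // big_ord_recr.
Qed.

(** The triangle [j + i < m + M] contains the rectangle [j < m], [i < M], outside of which [w]
    vanishes; on it ['C(k, j) / k!] splits as [1 / (j! i!)]. *)
Lemma exp_conv w m M :
    (forall j i, (m <= j)%N -> w j i = 0) ->
    (forall j i, (j < m)%N -> (M <= i)%N -> w j i = 0) ->
  \sum_(k < m + M) (k`!%:R^-1 : F) *: bin_conv w k =
  \sum_(j < m) (j`!%:R^-1 : F) *: \sum_(i < M) (i`!%:R^-1 : F) *: w j i.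
Proof.
move=> w0l w0r; pose u j i := (j`!%:R^-1 * i`!%:R^-1 : F) *: w j i.
transitivity (\sum_(k < m + M) \sum_(j < k.+1) u j (k - j)%N).
  apply: eq_bigr => k _; rewrite scaler_sumr; apply: eq_bigr => j _.
  by rewrite -scalerMnr scalerMnl bin_div_fact // -ltnS.
rewrite sum_triangle big_split_ord /= [X in _ + X]big1 ?addr0; last first.
  by move=> j _; rewrite big1 // => i _; rewrite /u w0l ?leq_addr ?scaler0.
apply: eq_bigr => j _; rewrite scaler_sumr.
have le_M : (M <= m + M - j)%N by rewrite addnC -addnBA ?leq_addr 1?ltnW.
rewrite (big_ord_widen _ (fun i => j`!%:R^-1 *: (i`!%:R^-1 *: w j i)) le_M).
rewrite [RHS]big_mkcond /=; apply: eq_bigr => i _.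
rewrite /u; case: ltnP => [_|le_Mi]; first by rewrite scalerA.
by rewrite w0r // scaler0.
Qed.

End Convolution.

(** * Conjugation by the exponential of a degree-lowering operator *)

Section LoweringExponential.
Variables (F : fieldType) (Q : {linear {poly F} -> {poly F}}).
Hypothesis charF0 : [pchar F] =i pred0.
Hypothesis lowerQ : forall f, (size (Q f) <= (size f).-1)%N.

Implicit Types (f : {poly F}) (A : operator F).

Let E := expv Q.

Lemma size_iter_lower j f : (size (iter j Q f) <= size f - j)%N.
Proof.
elim: j => [|j IH] /=; first by rewrite subn0.
by apply: leq_trans (lowerQ _) _; rewrite subnS -!subn1 leq_sub2r.
Qed.

Lemma iter_lower_eq0 j f : (size f <= j)%N -> iter j Q f = 0.
Proof.
move=> le_fj; apply/eqP; rewrite -size_poly_leq0.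
by apply: leq_trans (size_iter_lower _ _) _; rewrite leqn0 subn_eq0.
Qed.

(** The bound [m] is free, so that exponentials at several polynomials can be truncated at one
    common length. *)
Lemma exp_lowerE m f : (size f <= m)%N ->
  E f = \sum_(j < m) (j`!%:R^-1 : F) *: iter j Q f.
Proof. by move=> ?; apply: expvE; apply: iter_lower_eq0. Qed.

Lemma exp_lower_is_linear : linear E.
Proof.
move=> a u v; pose m := maxn (size (a *: u + v)) (maxn (size u) (size v)).
rewrite !(@exp_lowerE m) ?leq_max ?leqnn ?orbT // scaler_sumr -big_split /=.
by apply: eq_bigr => i _; rewrite linearP scalerDr !scalerA mulrC.
Qed.

Lemma exp_lower0 : E 0 = 0.
Proof. by rewrite (@exp_lowerE 0) ?size_poly0 // big_ord0. Qed.

Lemma exp_lowerD f g : E (f + g) = E f + E g.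
Proof. by rewrite -[f]scale1r exp_lower_is_linear !scale1r. Qed.

Lemma exp_lowerZ a f : E (a *: f) = a *: E f.
Proof. by rewrite -[a *: f]addr0 exp_lower_is_linear exp_lower0 addr0. Qed.

Lemma exp_lower_sum (I : Type) (r : seq I) (P : pred I) (f : I -> {poly F}) :
  E (\sum_(i <- r | P i) f i) = \sum_(i <- r | P i) E (f i).
Proof. exact: (big_morph E exp_lowerD exp_lower0). Qed.

Lemma comm_exp_lower (B : {linear {poly F} -> {poly F}}) :
  (forall f, Q (B f) = B (Q f)) -> forall f, E (B f) = B (E f).
Proof.
move=> QB f; pose m := maxn (size (B f)) (size f).
rewrite !(@exp_lowerE m) ?leq_max ?leqnn ?orbT // linear_sum.
apply: eq_bigr => i _; rewrite linearZ /=; congr (_ *: _).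
by elim: (i : nat) => //= n ->.
Qed.

(** The term of index 0 is [f] and all others have smaller degree: [E] is unitriangular in the
    monomial basis. *)
Lemma size_exp_lower f : (size (E f - f)%R <= (size f).-1)%N.
Proof.
rewrite (@exp_lowerE (size f).+1) // big_ord_recl /= fact0 invr1 scale1r.
rewrite addrC addKr; apply: leq_trans (size_sum _ _ _) _.
apply/bigmax_leqP => i _; apply: leq_trans (size_scale_leq _ _) _.
apply: leq_trans (lowerQ _) _; rewrite -!subn1 leq_sub2r //.
by rewrite (leq_trans (size_iter_lower _ _)) ?leq_subr.
Qed.

(** Leibniz rule, by induction on [k] from [Q X = ad_Q(X) + X Q]. *)
Lemma iter_op k A f :
  iter k Q (A f) = bin_conv (fun j i => iter_ad Q A j (iter i Q f)) k.
Proof.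
elim: k => [|k IH]; first by rewrite /bin_conv big_ord1.
rewrite iterS IH bin_convS /bin_conv -big_split linear_sum.
apply: eq_bigr => j _; rewrite linearMn /= -mulrnDl; congr (_ *+ _).
by symmetry; exact: subrK.
Qed.

(** The mirror rule, from [X Q = Q X - ad_Q(X)]. The new factor [Q] is peeled off next to [f], so
    the induction needs every [f]. *)
Lemma op_iter k A f :
  A (iter k Q f) =
  bin_conv (fun j i => (-1) ^+ j *: iter i Q (iter_ad Q A j f)) k.
Proof.
elim: k f => [|k IH] f; first by rewrite /bin_conv big_ord1 bin0 scale1r.
rewrite iterSr IH bin_convS /bin_conv -big_split /=.
apply: eq_bigr => j _; rewrite -mulrnDl /=; congr (_ *+ _).
rewrite -[ad Q _ f]/(Q (iter_ad Q A j f) - iter_ad Q A j (Q f)) linearB /=.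
by rewrite -iterSr iterS exprS mulN1r scaleNr scalerBr opprB subrK.
Qed.

Lemma exp_lower_op m (A : {linear {poly F} -> {poly F}}) f :
  iter_ad Q A m = 0 -> E (A f) = expv (ad Q) A (E f).
Proof.
move=> Am0; pose M := maxn (size (A f)) (size f).
rewrite (@exp_lowerE (m + M)); last first.
  by rewrite (leq_trans _ (leq_addl _ _)) // leq_maxl.
under eq_bigr => k _ do rewrite iter_op.
rewrite exp_conv //; last first.
- move=> j i _ le_Mi; rewrite iter_lower_eq0 ?linear0 //.
  exact: leq_trans (leq_maxr _ _) le_Mi.
- by move=> j i le_mj; rewrite /iter_ad (iter_eq0_leq Am0).
rewrite (expvE Am0) fct_sumE; apply: eq_bigr => j _.
rewrite (@exp_lowerE M) ?leq_maxr // scalrfctE; congr (_ *: _).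
by rewrite -/(iter_ad Q A j) linear_sum; apply: eq_bigr => i _; rewrite linearZ.
Qed.

(** This is [A E = E e^(-ad_Q)(A)], left as an explicit sum because its uses split off the term
    [j = 0]. *)
Lemma op_exp_lower m (A : {linear {poly F} -> {poly F}}) f :
  iter_ad Q A m = 0 ->
  A (E f) = \sum_(j < m) ((-1) ^+ j / j`!%:R : F) *: E (iter_ad Q A j f).
Proof.
(* [M] bounds the sizes of all polynomials to which [E] is applied on either side. *)
move=> Am0; pose M := maxn (size f) (\max_(j < m) size (iter_ad Q A j f)).
rewrite (@exp_lowerE (m + M)); last first.
  by rewrite (leq_trans _ (leq_addl _ _)) // leq_maxl.
rewrite linear_sum; under eq_bigr => k _ do rewrite linearZ /= op_iter.
rewrite exp_conv //; last first.
- move=> j i lt_jm le_Mi; rewrite iter_lower_eq0 ?scaler0 //.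
  apply: leq_trans _ le_Mi; apply: leq_trans _ (leq_maxr _ _).
  exact: (leq_bigmax (Ordinal lt_jm)).
- by move=> j i le_mj; rewrite /iter_ad (iter_eq0_leq Am0) // linear0 scaler0.
apply: eq_bigr => j _; rewrite (@exp_lowerE M); last first.
  exact: leq_trans (leq_bigmax j) (leq_maxr _ _).
rewrite mulrC -scalerA; congr (_ *: _); rewrite scaler_sumr.
by apply: eq_bigr => i _; rewrite !scalerA mulrC.
Qed.

End LoweringExponential.

(** * Commutation of [G] with polynomials in [x d/dx] and with [x] *)

Section DegreeLowering.
Variables (F : fieldType) (R : {poly F}).
Implicit Types (f p q : {poly F}) (A : operator F).

Local Notation G := (opG R).
Local Notation diag p := (op_poly p (@xddx F)).

Lemma coef_xddx f k : (xddx f)`_k = k%:R * f`_k.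
Proof.
rewrite /xddx /= /mulX /ddx coefXM coef_deriv mulr_natl.
by case: k.
Qed.

(** [p(H)] is diagonal on monomials, with eigenvalue [p(k)] on [x^k]; identities about it become
    identities of values. *)
Lemma coef_diag p f k : (diag p f)`_k = p.[k%:R] * f`_k.
Proof.
rewrite /op_poly coef_sum horner_coef mulr_suml.
apply: eq_bigr => i _; rewrite coefZ -mulrA; congr (_ * _).
elim: (i : nat) => [|j IH]; first by rewrite expr0 mul1r.
by rewrite iterS coef_xddx IH exprS mulrA.
Qed.

Lemma coef_opG f k : (G f)`_k = R.[k%:R] * (k.+1%:R * f`_k.+1).
Proof. by rewrite -[G f]/(diag R (ddx f)) coef_diag coef_deriv mulr_natl. Qed.

Lemma size_opG f : (size (G f) <= (size f).-1)%N.
Proof.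
apply/leq_sizeP => k le_fk; rewrite coef_opG nth_default ?mulr0 //.
by case: (size f) le_fk.
Qed.

Lemma opG_Xn n : G 'X^n = (n%:R * R.[n%:R - 1]) *: 'X^(n.-1).
Proof.
apply/polyP => k; rewrite coef_opG coefZ !coefXn.
(* At [n = 0] the factor [n%:R] vanishes, so the default [0.-1 = 0] is harmless. *)
case: n => [|n] /=; first by rewrite !mul0r !mulr0.
rewrite eqSS; case: eqP => [->|_]; last by rewrite !mulr0.
by rewrite !mulr1 mulrC -natr1 addrK.
Qed.

Lemma diag_Xn p n : diag p 'X^n = p.[n%:R] *: 'X^n.
Proof.
apply/polyP => k; rewrite coef_diag coefZ coefXn.
by case: eqP => [->|_] //; rewrite !mulr0.
Qed.

Lemma diagB p r f : diag (p - r) f = diag p f - diag r f.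
Proof. by apply/polyP=> k; rewrite coefB !coef_diag hornerD hornerN mulrBl. Qed.

Lemma diagD p r f : diag (p + r) f = diag p f + diag r f.
Proof. by apply/polyP=> k; rewrite coefD !coef_diag hornerD mulrDl. Qed.

Lemma diagZ c p f : diag (c *: p) f = c *: diag p f.
Proof. by apply/polyP=> k; rewrite coefZ !coef_diag hornerZ mulrA. Qed.

Lemma diag0 f : diag 0 f = 0.
Proof. by apply/polyP=> k; rewrite coef_diag horner0 coef0 mul0r. Qed.

Definition shift_poly i p := p \Po ('X - i%:R%:P).

(** Since [G] lowers degrees by one, [p(H) G = G p(H - 1)]; iterating composes the shifts. *)
Lemma diag_iter_opG p i f :
  diag p (iter i G f) = iter i G (diag (shift_poly i p) f).
Proof.
elim: i p => [|i IH] p; first by rewrite /shift_poly subr0 comp_polyXr.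
have diagG r g : diag r (G g) = G (diag (shift_poly 1 r) g).
  apply/polyP => k; rewrite coef_diag !coef_opG coef_diag /shift_poly.
  rewrite horner_comp hornerXsubC -natr1 addrK.
  by rewrite mulrCA; congr (_ * _); rewrite mulrCA.
rewrite !iterS diagG IH; congr (G (iter i G (diag _ f))).
rewrite /shift_poly -comp_polyA comp_polyB comp_polyX comp_polyC.
by rewrite -addrA -opprD -polyCD natr1.
Qed.

Lemma size_shift_poly i p : size (shift_poly i p) = size p.
Proof. by rewrite /shift_poly size_comp_poly2 ?size_XsubC. Qed.

(** A translation keeps the leading coefficient, so the difference loses a degree. This is what
    makes [ad_Q] nilpotent at [x]. *)
Lemma size_sub_shift_poly i p : (size (p - shift_poly i p)%R <= (size p).-1)%N.
Proof.
apply/leq_sizeP => k; rewrite leq_eqVlt => /orP[/eqP <-|lt_pk]; last first.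
  have le_pk : (size p <= k)%N by case: (size p) lt_pk.
  by rewrite coefB !nth_default ?subr0 ?size_shift_poly.
rewrite coefB -[in X in _ - X](size_shift_poly i p) -!lead_coefE.
rewrite lead_coef_comp ?size_XsubC // lead_coefXsubC expr1n mulr1.
exact: subrr.
Qed.

(** Induction by [[G^(i+2), x] = G [G^(i+1), x] + [G, x] G^(i+1)], where [[G, x] = p0(H)] moves to
    the right of [G^(i+1)] at the cost of a shift. *)
Lemma iter_opG_mulX i : exists2 p : {poly F}, (size p <= size R)%N &
  forall f, iter i.+1 G ('X * f) - 'X * iter i.+1 G f = iter i G (diag p f).
Proof.
(* On [x^k], [G x] acts by [(k+1) R(k)] and [x G] by [k R(k-1)]; their difference is [p0(k)]. *)
pose p0 := R + 'X * (R - shift_poly 1 R).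
have size_p0 : (size p0 <= size R)%N.
  rewrite (leq_trans (size_polyD _ _)) // geq_max leqnn /=.
  (* Multiplying by ['X] restores the degree lost by the difference; the count needs
     [size R > 0]. *)
  have [->|R0] := eqVneq R 0.
    by rewrite /shift_poly comp_poly0 subr0 mulr0 size_poly0.
  rewrite (leq_trans (size_polyMleq _ _)) // size_polyX /=.
  by rewrite (leq_ltn_trans (size_sub_shift_poly _ _)) //
    ltn_predL size_poly_gt0.
have p0E f : G ('X * f) - 'X * G f = diag p0 f.
  apply/polyP => k; rewrite coefB coef_diag coefXM !coef_opG !coefXM /=.
  rewrite /p0 /shift_poly !(horner_comp, hornerE).
  case: k => [|k] /=; first by ring.
  have -> : k.+1%:R - 1 = k%:R :> F by rewrite -natr1 addrK.
  by ring.
elim: i => [|i [p size_p IH]]; first by exists p0.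
exists (p + shift_poly i.+1 p0) => [|f].
  rewrite (leq_trans (size_polyD _ _)) // geq_max size_p.
  by rewrite size_shift_poly.
have -> : iter i.+1 G (diag (p + shift_poly i.+1 p0) f)
    = G (iter i G (diag p f)) + iter i.+1 G (diag (shift_poly i.+1 p0) f).
  by rewrite diagD linearD.
by rewrite -diag_iter_opG -p0E -IH linearB addrA subrK.
Qed.

End DegreeLowering.

(** * The operator [q(G)], its exponential and the eigenfunctions of [L] *)

Section Exponential.
Variables (F : fieldType) (R q : {poly F}).
Hypotheses (charF0 : [pchar F] =i pred0) (q0 : q`_0 = 0).
Implicit Types (f p : {poly F}) (A B : operator F).

Local Notation G := (opG R).
Local Notation diag p := (op_poly p (@xddx F)).
Local Notation Q := (op_poly q (opG R)).
Local Notation E := (expv Q).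
Local Notation P := (Pq R q).

(** Without constant term, every monomial of [q(G)] contains a factor [G]. *)
Lemma size_op_poly_opG f : (size (Q f) <= (size f).-1)%N.
Proof.
apply: leq_trans (size_sum _ _ _) _; apply/bigmax_leqP => -[[|i] lt_i] _ /=.
  by rewrite q0 scale0r size_poly0.
apply: leq_trans (size_scale_leq _ _) _; apply: leq_trans (size_opG _ _) _.
rewrite -!subn1 leq_sub2r //.
rewrite (leq_trans (size_iter_lower (@size_opG F R) i f)) //.
exact: leq_subr.
Qed.

Let lowerQ := size_op_poly_opG.

Lemma op_poly_widen n p A f : (size p <= n)%N ->
  op_poly p A f = \sum_(i < n) p`_i *: iter i A f.
Proof.
move=> le_pn; rewrite /op_poly.
rewrite (big_ord_widen _ (fun i => p`_i *: iter i A f) le_pn).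
rewrite big_mkcond; apply: eq_bigr => i _ /=; case: ltnP => // le_pi.
by rewrite nth_default // scale0r.
Qed.

Lemma xddx_diag f : xddx f = diag 'X f.
Proof. by apply/polyP => k; rewrite coef_xddx coef_diag hornerX. Qed.

Lemma xddx_iter_opG i f : xddx (iter i G f) = iter i G (xddx f - i%:R *: f).
Proof.
rewrite xddx_diag diag_iter_opG /shift_poly comp_polyX diagB -xddx_diag.
congr (iter i G (_ - _)).
by apply/polyP => k; rewrite coef_diag hornerC coefZ.
Qed.

(** By [H G^i = G^i (H - i)], each power contributes [[G^i, H] = i G^i], which is the term of
    [q'(G) G]. *)
Lemma ad_xddx f : ad Q (@xddx F) f = op_poly q^`() G (G f).
Proof.
have qS : (size q <= (size q).-1.+1)%N by rewrite leqSpred.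
rewrite -[LHS]/(Q (xddx f) - xddx (Q f)) !(op_poly_widen _ _ qS) linear_sum.
rewrite -sumrB big_ord_recl q0 !scale0r linear0 subr0 add0r.
have q'S : (size q^`() <= (size q).-1)%N.
  apply/leq_sizeP => i le_qi; rewrite coef_deriv nth_default ?mul0rn //.
  by case: (size q) le_qi.
rewrite (op_poly_widen _ _ q'S); apply: eq_bigr => i _; rewrite lift0.
rewrite linearZZ -scalerBr [X in _ *: (_ - X)]xddx_iter_opG.
rewrite [X in _ *: (_ - X)]linearB opprB addrC subrK [X in _ *: X]linearZZ.
by rewrite coef_deriv scalerA mulr_natr; congr (_ *: _); exact: iterSr.
Qed.

Lemma comm_opG_Q f : Q (G f) = G (Q f).
Proof. by apply: comm_op_poly. Qed.

Lemma xddx_exp f : opL R q (E f) = E (xddx f).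
Proof.
pose D : operator F := op_poly q^`() G \o G.
have QD f1 : Q (D f1) = D (Q f1).
  rewrite /D /= -comm_opG_Q; apply/esym/comm_op_poly => g.
  exact/esym/comm_opG_Q.
have ad1 : iter_ad Q (@xddx F) 1 = D by apply/funext => g; exact: ad_xddx.
have ad2 : iter_ad Q (@xddx F) 2 = 0.
  apply/funext => g; rewrite iter_adS ad1 QD; exact: subrr.
(* The series [e^(-ad_Q)(H)] stops at [H - D], so [H E = E H - E D]; as [E D = D E], the two [D]
   terms cancel. *)
rewrite -[opL R q _]/(D (E f) + xddx (E f)).
rewrite (op_exp_lower charF0 lowerQ _ ad2) big_ord_recl big_ord1 ad1.
rewrite /= fact0 expr0 divr1 scale1r expr1 divr1 scaleN1r.
by rewrite (comm_exp_lower lowerQ QD) addrCA subrr addr0.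
Qed.

(** Used to see that [P_n] is nonzero, as an eigenfunction must be. *)
Lemma coef_Pq n : (P n%:Z)`_n = 1.
Proof.
have := size_exp_lower lowerQ 'X^n; rewrite size_polyXn.
move=> /leq_sizeP/(_ n (leqnn n)).
by rewrite coefB coefXn eqxx => /eqP; rewrite subr_eq0 => /eqP.
Qed.

Lemma eigenfunction_Pq n : eigenfunction (opL R q) (P n%:Z).
Proof.
split.
  apply: contraTneq (oner_neq0 F) => P0.
  by rewrite -(coef_Pq n) P0 coef0 eqxx.
exists n%:R; rewrite xddx_exp xddx_diag diag_Xn hornerX.
by rewrite (exp_lowerZ lowerQ).
Qed.

End Exponential.

(** * The normal-form filtration and nilpotency of [ad_Q] at [x] *)

Section Filtration.
Variables (F : fieldType) (R q : {poly F}) (d l : nat).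
Hypotheses (degR : size R = d.+1) (degq : size q = l.+1) (q0 : q`_0 = 0).
Implicit Types (f p : {poly F}) (A B : operator F).

Local Notation G := (opG R).
Local Notation diag p := (op_poly p (@xddx F)).
Local Notation Q := (op_poly q (opG R)).

(* The operators sum_(a < N) G^a c_a(H) with every c_a of degree < s. *)
Definition normal_form N s A := exists2 c : nat -> {poly F},
  forall a, (size (c a) <= s)%N &
  forall f, A f = \sum_(a < N) iter a G (diag (c a) f).

Lemma normal_form0 N s : normal_form N s 0.
Proof.
exists (fun=> 0) => [a|f]; first by rewrite size_poly0.
by rewrite big1 // => a _; rewrite diag0 linear0.
Qed.

Lemma normal_formD N s A B :
  normal_form N s A -> normal_form N s B -> normal_form N s (A + B).
Proof.
move=> [c sc Ac] [b sb Bb]; exists (fun a => c a + b a) => [a|f].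
  by rewrite (leq_trans (size_polyD _ _)) // geq_max sc sb.
rewrite -[LHS]/(A f + B f) Ac Bb -big_split; apply: eq_bigr => a _.
by rewrite diagD linearD.
Qed.

Lemma normal_formZ N s x A : normal_form N s A -> normal_form N s (x *: A).
Proof.
move=> [c sc Ac]; exists (fun a => x *: c a) => [a|f].
  exact: leq_trans (size_scale_leq _ _) _.
rewrite -[LHS]/(x *: A f) Ac scaler_sumr; apply: eq_bigr => a _.
by rewrite diagZ linearZZ.
Qed.

Lemma normal_form_sum N s (I : Type) (r : seq I) (P : pred I)
    (A : I -> operator F) :
    (forall i, P i -> normal_form N s (A i)) ->
  normal_form N s (\sum_(i <- r | P i) A i).
Proof.
by move=> nA; elim/big_ind: _ => //;
  [exact: normal_form0 | exact: normal_formD].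
Qed.

Lemma normal_form_monomial N s a p : (a < N)%N -> (size p <= s)%N ->
  normal_form N s (fun f => iter a G (diag p f)).
Proof.
move=> lt_aN size_p; exists (fun b => if b == a then p else 0) => [b|f].
  by case: eqP => // _; rewrite size_poly0.
rewrite (bigD1 (Ordinal lt_aN)) //= eqxx big1 ?addr0 // => b neq_ba.
by rewrite ifN ?diag0 ?linear0.
Qed.

(** The family [c] is unconstrained from [N] on as far as [A] goes, so [A] is first rebuilt from its
    [N] monomials. *)
Lemma normal_form_leq N N' s s' A : (N <= N')%N -> (s <= s')%N ->
  normal_form N s A -> normal_form N' s' A.
Proof.
move=> le_N le_s [c sc Ac].
have -> : A = \sum_(a < N) fun f => iter a G (diag (c a) f).
  by apply/funext => f; rewrite Ac fct_sumE.
apply: normal_form_sum => a _.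
by apply: normal_form_monomial; rewrite ?(leq_trans _ le_N) ?(leq_trans _ le_s).
Qed.

(** [[G^i, G^a c(H)] = G^(a+i) (c(H) - c(H - i))] with [i <= l]: the range grows by [l] and the size
    drops by one. *)
Lemma normal_form_ad N s A :
  normal_form N s A -> normal_form (N + l) s.-1 (ad Q A).
Proof.
move=> [c sc Ac].
have -> : ad Q A = \sum_(a < N) \sum_(i < l.+1) q`_i *:
    (fun f => iter (a + i) G (diag (c a - shift_poly i (c a)) f)).
  apply/funext => f; rewrite fct_sumE -[LHS]/(Q (A f) - A (Q f)) !Ac linear_sum.
  rewrite -sumrB; apply: eq_bigr => a _.
  rewrite fct_sumE.
  transitivity (iter a G (\sum_(i < l.+1) q`_i *:
      (iter i G (diag (c a) f) - diag (c a) (iter i G f)))).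
    under [in RHS]eq_bigr do rewrite scalerBr.
    rewrite sumrB [RHS]linearB; congr (_ - _).
      rewrite [LHS](op_poly_widen _ _ (eq_leq degq)) [RHS]linear_sum.
      apply: eq_bigr => i _; by rewrite [RHS]linearZZ /= -!iterD addnC.
    congr (iter a G _); rewrite (op_poly_widen _ _ (eq_leq degq)) linear_sum.
    by apply: eq_bigr => i _; rewrite linearZZ.
  rewrite linear_sum; apply: eq_bigr => i _; rewrite linearZZ scalrfctE.
  congr (_ *: _); rewrite diag_iter_opG iterD diagB.
  by congr (iter a G _); rewrite linearB.
apply: normal_form_sum => a _; apply: normal_form_sum => i _.
apply/normal_formZ/normal_form_monomial.
  by rewrite -addSn leq_add // -ltnS.
apply: leq_trans (size_sub_shift_poly _ _) _.
by rewrite -!subn1 leq_sub2r.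
Qed.

Lemma normal_form_ad_mulX : normal_form l d.+1 (ad Q (@mulX F)).
Proof.
have -> : ad Q (@mulX F) = \sum_(i < l) q`_i.+1 *:
    (fun f => iter i.+1 G ('X * f) - 'X * iter i.+1 G f).
  apply/funext => f; rewrite fct_sumE -[LHS]/(Q ('X * f) - mulX (Q f)).
  rewrite !(op_poly_widen _ _ (eq_leq degq)) linear_sum -sumrB.
  (* With [i = 0] gone, only [[G^(i+1), x] = G^i p(H)] with [i < l] remain. *)
  rewrite big_ord_recl q0 !scale0r linear0.
  rewrite subr0 add0r; apply: eq_bigr => i _.
  by rewrite lift0 linearZZ -scalerBr.
apply: normal_form_sum => i _; apply: normal_formZ.
have [p size_p pE] := iter_opG_mulX R i.
by rewrite (funext pE); apply: normal_form_monomial; rewrite // -degR.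
Qed.

Lemma normal_form_iter_ad j :
  normal_form (l + j * l) (d.+1 - j) (iter_ad Q (@mulX F) j.+1).
Proof.
elim: j => [|j IH]; first by rewrite addn0 subn0; exact: normal_form_ad_mulX.
by rewrite mulSn [(l + (j * l))%N]addnC addnA subnS; apply: normal_form_ad.
Qed.

(** After [d + 2] brackets the size bound on the coefficients is [d.+1 - d.+1 = 0]. *)
Lemma iter_ad_mulX_eq0 : iter_ad Q (@mulX F) d.+2 = 0.
Proof.
have [c sc cE] := normal_form_iter_ad d.+1; apply/funext => f.
rewrite cE big1 // => a _; have := sc a.
rewrite subnn size_poly_leq0 => /eqP ->.
by rewrite diag0 linear0.
Qed.

End Filtration.

(** * Lowering, raising, recurrence and Rodrigues formula *)

Section RaisingLowering.
Variables (F : fieldType) (R q : {poly F}) (d l : nat).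
Hypotheses (charF0 : [pchar F] =i pred0).
Hypotheses (degR : size R = d.+1) (degq : size q = l.+1) (q0 : q`_0 = 0).

Local Notation G := (opG R).
Local Notation Q := (op_poly q (opG R)).
Local Notation P := (Pq R q).

Let lowerQ := size_op_poly_opG R q0.

(** Indexed by integers so that [G] can be iterated past [P_0], where both sides are 0. *)
Definition lowering_coef (k : int) : F := k%:~R * R.[k%:~R - 1].

(** [G] commutes with [E], so it suffices to know [G x^n]. *)
Lemma opG_Pq k : G (P k) = lowering_coef k *: P (k - 1).
Proof.
case: k => [n|n] /=; last by rewrite linear0 scaler0.
rewrite -[LHS](comm_exp_lower lowerQ (@comm_opG_Q F R q)) /=.
rewrite opG_Xn (exp_lowerZ lowerQ).
rewrite /lowering_coef; case: n => [|n]; first by rewrite !mul0r !scale0r.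
by have -> : n.+1%:Z - 1 = n%:Z by rewrite intS addrC addKr.
Qed.

Lemma iter_opG_Pq a k :
  iter a G (P k) = (\prod_(i < a) lowering_coef (k - i%:Z)) *: P (k - a%:Z).
Proof.
elim: a => [|a IH]; first by rewrite big_ord0 scale1r subr0.
rewrite iterS IH linearZZ /= opG_Pq scalerA big_ord_recr /= -addrA -opprD.
by rewrite -PoszD addn1.
Qed.

Lemma raising_Pq n : opM R q (P n%:Z) = P n.+1%:Z.
Proof.
rewrite /opM /sigma.
rewrite -(exp_lower_op charF0 lowerQ _ (iter_ad_mulX_eq0 degR degq q0)).
by rewrite /= /mulX -exprS.
Qed.

Lemma Pq_recurrence : exists gamma : nat -> nat -> F, forall n : nat,
  'X * P n%:Z = P n.+1%:Z
    + \sum_(0 <= j < l * d + l) gamma j n *: P (n%:Z - j%:Z).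
Proof.
(* [B = e^(-ad_Q)(x) - x]. Its normal form has range [l + j * l <= l * d + l] because [j <= d]. *)
pose B := \sum_(j < d.+1)
  ((-1) ^+ j.+1 / j.+1`!%:R : F) *: iter_ad Q (@mulX F) j.+1.
have [c _ cE] : normal_form R (l * d + l) d.+1 B.
  apply: normal_form_sum => j _; apply: normal_formZ.
  apply: normal_form_leq (normal_form_iter_ad degR degq q0 j).
    by rewrite addnC leq_add2r mulnC leq_mul2l -ltnS ltn_ord orbT.
  exact: leq_subr.
(* [G^j c_j(H)] sends [x^n] to [c_j(n) G^j x^n], and [E G^j x^n = G^j P_n] is the product of
   lowering factors times [P_(n-j)]. *)
exists (fun j n =>
  (c j).[n%:R] * \prod_(i < j) lowering_coef (n%:Z - i%:Z)) => n.
rewrite -[LHS]/(mulX (expv Q 'X^n)).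
rewrite (op_exp_lower charF0 lowerQ _ (iter_ad_mulX_eq0 degR degq q0)).
(* The term [j = 0] is [E (x x^n) = P_(n+1)]. *)
rewrite big_ord_recl fact0 expr0 divr1 scale1r {1}/iter_ad /= /mulX -exprS.
congr (_ + _); transitivity (expv Q (B 'X^n)).
  rewrite /B fct_sumE (exp_lower_sum lowerQ); apply: eq_bigr => j _.
  by rewrite scalrfctE (exp_lowerZ lowerQ).
rewrite cE (exp_lower_sum lowerQ) big_mkord; apply: eq_bigr => a _.
rewrite diag_Xn linearZZ (exp_lowerZ lowerQ) -scalerA -iter_opG_Pq.
congr (_ *: _); apply: (comm_exp_lower lowerQ) => f.
by elim: (a : nat) f => //= b IH f; rewrite comm_opG_Q IH.
Qed.

Lemma Rodrigues_Pq n : P n%:Z = iter n (opM R q) 1.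
Proof.
elim: n => [|n IH]; last by rewrite iterS -IH raising_Pq.
rewrite /= expr0 (exp_lowerE lowerQ (m := 1)) ?size_poly1 // big_ord1.
by rewrite fact0 invr1 scale1r.
Qed.

End RaisingLowering.

Theorem theorem4p2 (F : fieldType) (charF0 : [pchar F] =i pred0)
    (d : nat) (R : {poly F}) (degR : size R = d.+1)
    (l : nat) (l_ge1 : (1 <= l)%N)
    (q : {poly F}) (degq : size q = l.+1) (q0 : q`_0 = 0) :
  [/\ forall n : nat, eigenfunction (opL R q) (Pq R q n%:Z),
      exists gamma : nat -> nat -> F, forall n : nat,
        'X * Pq R q n%:Z = Pq R q n.+1%:Z
          + \sum_(0 <= j < l * d + l) gamma j n *: Pq R q (n%:Z - j%:Z),
      (forall n : nat,
        opG R (Pq R q n%:Z) = (n%:R * R.[n%:R - 1]) *: Pq R q (n%:Z - 1)) /\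
      (forall n : nat, opM R q (Pq R q n%:Z) = Pq R q n.+1%:Z)
    & forall n : nat, Pq R q n%:Z = iter n (opM R q) 1].
Proof.
split; first exact: eigenfunction_Pq.
- exact: Pq_recurrence charF0 degR degq q0.
- by split=> n; [exact: opG_Pq | exact: raising_Pq charF0 degR degq q0 n].
- exact: Rodrigues_Pq charF0 degR degq q0.
Qed.
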